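(* Let $(B,\cdot)$ be a left loop with identity $1$, and let $\phi\in\mathrm{Sym}(B)$. Then: (1) $\phi\in\mathrm{Sym}_1(B)$ if and only if $\mu_x(\phi)\in\mathrm{Sym}_1(B)$ for all $x\in B$. (2) $\phi\in\mathrm{PsAut}(B)$ if and only if there exists $c\in B$ such that $\mu_x(\phi)=L(c,\phi(x))^{-1}$ for all $x\in B$. (3) $\phi\in\mathrm{Aut}(B)$ if and only if $\mu_x(\phi)=I$ (the identity permutation) for all $x\in B$.
   Context: A left loop $(B,\cdot)$ is a set with a binary operation such that for each $a\in B$ the left translation $L_a:B\to B$, $L_a x=a\cdot x$, is a bijection, and there is a two-sided identity $1\in B$. $\mathrm{Sym}(B)$ is the group of permutations of $B$ and $\mathrm{Sym}_1(B)$ the subgroup of permutations fixing $1$. The left inner mappings are $L(x,y)=L_{x\cdot y}^{-1}L_xL_y$ for $x,y\in B$. The deviation of $\phi\in\mathrm{Sym}(B)$ at $x\in B$ is $\mu_x(\phi)=L_{\phi(x)}^{-1}\phi L_x\phi^{-1}\in\mathrm{Sym}(B)$. A permutation $\phi$ of $B$ is a pseudo-automorphism with companion $c\in B$ if $c\cdot\phi(x\cdot y)=(c\cdot\phi(x))\cdot\phi(y)$ for all $x,y\in B$; $\mathrm{PsAut}(B)$ is the set of permutations that are pseudo-automorphisms with some companion. $\mathrm{Aut}(B)$ is the set of permutations $\phi$ with $\phi(x\cdot y)=\phi(x)\cdot\phi(y)$ for all $x,y$. *)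

(* Defs.v *)
From HB Require Import structures.
From mathcomp Require Import all_boot.
From mathcomp Require Import boolp classical_sets.

Set Implicit Arguments.
Unset Strict Implicit.
Unset Printing Implicit Defensive.

Local Open Scope group_scope.

HB.mixin Record BaseUMagma_isLeftLoop B of BaseUMagma B := {
  lloop_bij : forall a : B, bijective (fun x : B => a * x);
  lloop_mul1x : left_id (1 : B) (@mul B);
  lloop_mulx1 : right_id (1 : B) (@mul B)
}.

(* Not a umagmaType, since the latter also requires a choiceType carrier. *)
#[short(type="leftLoopType")]
HB.structure Definition LeftLoop :=
  {B of BaseUMagma_isLeftLoop B & BaseUMagma B}.

Record Sym (B : Type) := MkSym {
  sym_fun :> B -> B;
  sym_bij : bijective sym_fun
}.

Section SymGroup.
Variable B : Type.
Implicit Types f g h : Sym B.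

Lemma symP f g : f =1 g -> f = g.
Proof.
case: f g => [f fb] [g gb] /= /funext fg.
by subst g; congr MkSym; exact: Prop_irrelevance.
Qed.

Lemma sym_inv_subproof f :
  exists g : Sym B, cancel f g /\ cancel g f.
Proof.
have [g fK gK] := sym_bij f.
by exists (MkSym (Bijective gK fK)).
Qed.

Definition sym_one : Sym B := MkSym (Bijective (frefl id) (frefl id)).
(* (f * g)(x) = f (g x), the opposite of the convention for {perm T}. *)
Definition sym_mul f g : Sym B := MkSym (bij_comp (sym_bij f) (sym_bij g)).
Definition sym_inv f : Sym B := projT1 (cid (sym_inv_subproof f)).

Lemma symK f : cancel f (sym_inv f).
Proof. by rewrite /sym_inv; case: cid => g []. Qed.

Lemma symVK f : cancel (sym_inv f) f.
Proof. by rewrite /sym_inv; case: cid => g []. Qed.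

Lemma sym_mulA : associative sym_mul.
Proof. by move=> f g h; apply: symP. Qed.

Lemma sym_mul1g : left_id sym_one sym_mul.
Proof. by move=> f; apply: symP. Qed.

Lemma sym_mulg1 : right_id sym_one sym_mul.
Proof. by move=> f; apply: symP. Qed.

Lemma sym_mulVg : left_inverse sym_one sym_inv sym_mul.
Proof. by move=> f; apply: symP => x; exact: symK. Qed.

Lemma sym_mulgV : right_inverse sym_one sym_inv sym_mul.
Proof. by move=> f; apply: symP => x; exact: symVK. Qed.

HB.instance Definition _ := gen_eqMixin (Sym B).
HB.instance Definition _ := gen_choiceMixin (Sym B).
HB.instance Definition _ := isGroup.Build (Sym B)
  sym_mulA sym_mul1g sym_mulg1 sym_mulVg sym_mulgV.

Lemma sym1E x : (1 : Sym B) x = x. Proof. by []. Qed.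
Lemma symME f g x : (f * g) x = f (g x). Proof. by []. Qed.

End SymGroup.

Section LeftLoopDefs.
Variable B : leftLoopType.

Definition ltrans (a : B) : Sym B := MkSym (lloop_bij a).

Definition linner (x y : B) : Sym B := (ltrans (x * y))^-1 * ltrans x * ltrans y.

Definition deviation (x : B) (phi : Sym B) : Sym B :=
  (ltrans (phi x))^-1 * phi * ltrans x * phi^-1.

Definition Sym1 : set (Sym B) := [set phi | phi 1 = 1].

Definition pseudo_automorphism (phi : Sym B) (c : B) : Prop :=
  forall x y : B, c * phi (x * y) = (c * phi x) * phi y.

Definition PsAut : set (Sym B) :=
  [set phi | exists c : B, pseudo_automorphism phi c].

Definition Aut : set (Sym B) :=
  [set phi | forall x y : B, phi (x * y) = phi x * phi y].

End LeftLoopDefs.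

Arguments Sym1 : clear implicits.
Arguments PsAut : clear implicits.
Arguments Aut : clear implicits.

(* Main.v *)
Require Import Defs.
From mathcomp Require Import all_boot.
From mathcomp Require Import boolp classical_sets.

Local Open Scope group_scope.

(** The deviation measures the failure of multiplicativity: [deviation x phi]
    is the unique permutation [psi] with [phi (x * y) = phi x * psi (phi y)]
    for all [y]. Each part compares this with the equation defining the
    corresponding class of permutations. *)

Lemma sym_invK {B : Type} (f : Sym B) : cancel f f^-1.
Proof. exact: symK. Qed.

Lemma sym_invVK {B : Type} (f : Sym B) : cancel f^-1 f.
Proof. exact: symVK. Qed.

Lemma lloop_mulI {B : leftLoopType} (a : B) : injective (fun x : B => a * x).
Proof. exact: bij_inj (lloop_bij a). Qed.

Lemma mul_ltransV {B : leftLoopType} (a x : B) : a * (ltrans a)^-1 x = x.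
Proof. exact: (sym_invVK (ltrans a)). Qed.

Lemma deviationE {B : leftLoopType} (phi : Sym B) (x y : B) :
  phi (x * y) = phi x * deviation x phi (phi y).
Proof. by rewrite /deviation !symME mul_ltransV sym_invK. Qed.

(** Uniqueness holds because [phi] is onto and left translations are injective. *)
Lemma deviation_eqP {B : leftLoopType} (phi psi : Sym B) (x : B) :
  deviation x phi = psi <-> (forall y, phi (x * y) = phi x * psi (phi y)).
Proof.
split=> [<- y|h]; first exact: deviationE.
apply: symP => z; apply: (lloop_mulI (phi x)).
by rewrite -(sym_invVK phi z) -deviationE h.
Qed.

(** Substitute [z = linner c a w] in [(c * a) * linner c a w = c * (a * w)]. *)
Lemma mul_linnerV {B : leftLoopType} (c a z : B) :
  c * (a * (linner c a)^-1 z) = (c * a) * z.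
Proof.
rewrite -{2}(sym_invVK (linner c a) z).
by rewrite [in RHS]/linner !symME mul_ltransV.
Qed.

Lemma Sym1_deviationP {B : leftLoopType} (phi : Sym B) :
  Sym1 B phi <-> (forall x : B, Sym1 B (deviation x phi)).
Proof.
split=> [phi1 x|dev1].
  apply: (lloop_mulI (phi x)).
  (* Writing the argument [1] as [phi 1] allows [deviationE] at [y = 1]. *)
  by rewrite -{1}(phi1 : phi 1 = 1) -deviationE !lloop_mulx1.
(* This [y] satisfies [phi y = 1], so the identity at [x = 1] reads
   [1 = phi 1 * deviation 1 phi 1]. *)
have := deviationE phi 1 (phi^-1 1).
by rewrite lloop_mul1x sym_invVK (dev1 1 : deviation 1 phi 1 = 1) lloop_mulx1.
Qed.

Lemma PsAut_deviationP {B : leftLoopType} (phi : Sym B) :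
  PsAut B phi <->
    (exists c : B, forall x : B, deviation x phi = (linner c (phi x))^-1).
Proof.
split=> -[c h]; exists c.
  (* Multiplied on the left by [c], the deviation equation becomes the companion identity. *)
  move=> x; apply/deviation_eqP => y; apply: (lloop_mulI c).
  by rewrite mul_linnerV h.
by move=> x y; move/deviation_eqP: (h x) => ->; rewrite mul_linnerV.
Qed.

Lemma Aut_deviationP {B : leftLoopType} (phi : Sym B) :
  Aut B phi <-> (forall x : B, deviation x phi = 1).
Proof.
split=> h x; first by apply/deviation_eqP => y; rewrite h.
by move/deviation_eqP: (h x).
Qed.

Theorem proposition2p1 (B : leftLoopType) (phi : Sym B) :
  [/\ Sym1 B phi <-> (forall x : B, Sym1 B (deviation x phi)),
      PsAut B phi <->
        (exists c : B, forall x : B, deviation x phi = (linner c (phi x))^-1)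
    & Aut B phi <-> (forall x : B, deviation x phi = 1)].
Proof.
split; [exact: Sym1_deviationP|exact: PsAut_deviationP|exact: Aut_deviationP].
Qed.
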